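(* The $q$-binomial-Eulerian polynomials satisfy, for all integers $n\ge0$, the recurrence relation $$\tilde{A}_{n+1}(t,q)=(1+t)\tilde{A}_{n}(t,q)+t\sum_{k=1}^n{n\brack k}_qq^kA_k(t,q)\tilde{A}_{n-k}(t,q),$$ with initial value $\tilde{A}_{0}(t,q)=1$.
   Context: Let $\mathfrak S_n$ be the set of permutations of $[n]=\{1,\dots,n\}$. For $\pi=\pi_1\cdots\pi_n\in\mathfrak S_n$ let $\mathrm{exc}(\pi)=|\{i\in[n-1]:\pi_i>i\}|$ and $\mathrm{maj}(\pi)=\sum_{i\in[n-1],\,\pi_i>\pi_{i+1}} i$. Let $$A_n(t,q)=\sum_{\pi\in\mathfrak S_n}t^{\mathrm{exc}(\pi)}q^{\mathrm{maj}(\pi)-\mathrm{exc}(\pi)}\ (n\ge1),\qquad \tilde A_n(t,q)=1+t\sum_{m=1}^n{n\brack m}_qA_m(t,q)\ (n\ge0),$$ where ${n\brack m}_q=\frac{(q;q)_n}{(q;q)_m(q;q)_{n-m}}$, $(q;q)_n=\prod_{i=1}^n(1-q^i)$, is the $q$-binomial coefficient. *)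

(* Defs.v *)
From mathcomp Require Import all_boot all_order all_fingroup all_algebra.
From mathcomp Require Import zify ring.

Set Implicit Arguments.
Unset Strict Implicit.
Unset Printing Implicit Defensive.

Import GRing.Theory.
Local Open Scope ring_scope.

(* Permutations of [n] = {1, ..., n} are elements of 'S_n, which acts on       *)
(* {0, ..., n-1}. The one-line word shifts the values to {1, ..., n}, and      *)
(* [letter s i] is its i-th letter with i counted from 1, so that [letter s i] *)
(* is meaningful exactly for 1 <= i <= n.                                      *)
Definition oneline n (s : 'S_n) : seq nat := [seq (s j).+1 | j <- enum 'I_n].

Definition letter n (s : 'S_n) (i : nat) : nat := nth 0 (oneline s) i.-1.

Definition exc n (s : 'S_n) : nat := (\sum_(1 <= i < n | i < letter s i) 1)%N.

Definition maj n (s : 'S_n) : nat :=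
  (\sum_(1 <= i < n | letter s i.+1 < letter s i) i)%N.

Lemma letterE n (s : 'S_n) (j : 'I_n) : letter s j.+1 = (s j).+1.
Proof.
by rewrite /letter /= (nth_map j) ?size_enum_ord // nth_ord_enum.
Qed.

(* So the truncated subtraction [maj s - exc s] is the true difference.        *)
Lemma exc_le_maj n (s : 'S_n) : (exc s <= maj s)%N.
Proof.
pose P k := (0 < k < n)%N && (k < letter s k)%N.
have [k0 Pk0|noP] := pickP (fun k : 'I_n => P k); last first.
  rewrite /exc big_nat_cond big1 // => i /andP[/andP[i0 lin] ilt].
  by have := noP (Ordinal lin); rewrite /P /= i0 lin ilt.
have exP : exists k, P k by exists k0.
have ubP k : P k -> (k <= n)%N by case/andP=> /andP[_ /ltnW].
case: (ex_maxnP exP ubP) => k /andP[/andP[k_gt0 ltkn] kexc] kmax.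
have le_exc : (exc s <= k)%N.
  have -> : exc s = (\sum_(1 <= i < n | (i < letter s i) && (i <= k)) 1)%N.
    rewrite /exc big_nat_cond [RHS]big_nat_cond; apply: eq_bigl => i.
    case: (boolP ((1 <= i < n)%N)) => //= lin.
    case: (boolP (i < letter s i)%N) => //= ei.
    by rewrite kmax // /P lin ei.
  rewrite sum1_count.
  rewrite (leq_trans (sub_count (a2 := fun i => (i <= k)%N) _ _)) //.
    by move=> i /andP[].
  have -> : index_iota 1 n = index_iota 1 k.+1 ++ index_iota k.+1 n.
    rewrite /index_iota (_ : (n - 1 = k + (n - k.+1))%N); last lia.
    by rewrite iotaD add1n subn1.
  rewrite count_cat [X in (_ + X)%N](_ : _ = 0%N); last first.
    apply/eqP; rewrite -leqn0 leqNgt -has_count; apply/hasPn => i.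
    by rewrite mem_index_iota -ltnNge => /andP[].
  by rewrite addn0 (leq_trans (count_size _ _)) // size_iota subn1.
have [d /andP[/andP[lekd ltdn] dd]|nod] :=
    pickP (fun d : 'I_n => (k <= d < n)%N && (letter s d.+1 < letter s d)%N).
  apply: (leq_trans le_exc); apply: (leq_trans lekd).
  rewrite /maj (big_rem (d : nat)) /=; last by rewrite mem_index_iota; lia.
  by rewrite dd leq_addr.
have incr m : (k + m < n.+1)%N -> (k + m < letter s (k + m))%N.
  elim: m => [|m IH] lt_n; first by rewrite addn0.
  have ltn1 : (k + m < n)%N by lia.
  have ltn2 : ((k + m).-1 < n)%N by lia.
  have := IH (ltnW ltn1); have := nod (Ordinal ltn1).
  rewrite /= leq_addr ltn1 /= => /negbT; rewrite -leqNgt addnS.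
  have := letterE s (Ordinal ltn1); have := letterE s (Ordinal ltn2).
  rewrite /= prednK ?addn_gt0 ?k_gt0 // => -> ->.
  have : s (Ordinal ltn2) <> s (Ordinal ltn1) :> nat.
    by move/val_inj/perm_inj => [] /eqP; lia.
  lia.
have n1n : (n.-1 < n)%N by lia.
have := incr (n - k)%N; rewrite subnKC ?(ltnW ltkn) // ltnSn => /(_ isT).
have := letterE s (Ordinal n1n); rewrite /= prednK; last lia.
by move=> ->; have := ltn_ord (s (Ordinal n1n)); lia.
Qed.

(* (q; q)_n, with q the variable of {poly int}.                                *)
Definition qpoch (n : nat) : {poly int} := \prod_(1 <= i < n.+1) (1 - 'X^i).

Definition qbinom (n m : nat) : {poly int} :=
  qpoch n %/ (qpoch m * qpoch (n - m)).

Lemma qpochS n : qpoch n.+1 = qpoch n * (1 - 'X^(n.+1)).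
Proof. by rewrite /qpoch big_nat_recr. Qed.

Lemma qpoch_dvd m k :
  exists g : {poly int}, qpoch (m + k) = g * (qpoch m * qpoch k).
Proof.
have [n] := ubnP (m + k); elim: n m k => // n IH [|m] [|k] lt_n.
- by exists 1; rewrite /qpoch !big_geq // !mulr1.
- by exists 1; rewrite mul1r add0n {2}/qpoch big_geq // mul1r.
- by exists 1; rewrite mul1r addn0 {3}/qpoch big_geq // mulr1.
have [|g1 e1] := IH m k.+1; first lia.
have [|g2 e2] := IH m.+1 k; first lia.
exists (g1 + 'X^(m.+1) * g2).
have -> : (m.+1 + k.+1 = (m + k.+1).+1)%N by lia.
have -> : qpoch (m + k.+1).+1 =
    qpoch (m + k.+1) * (1 - 'X^(m.+1))
      + 'X^(m.+1) * (qpoch (m.+1 + k) * (1 - 'X^(k.+1))).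
  rewrite (_ : (m.+1 + k = m + k.+1)%N); last lia.
  rewrite qpochS (_ : 'X^((m + k.+1).+1) = 'X^(m.+1) * 'X^(k.+1)); last first.
    by rewrite -exprD; congr ('X^_); lia.
  by ring.
by rewrite e1 e2 (qpochS m) (qpochS k); ring.
Qed.

Lemma lead_coef_qpoch n : lead_coef (qpoch n) \is a GRing.unit.
Proof.
elim: n => [|n IH]; first by rewrite /qpoch big_geq // lead_coef1 unitr1.
rewrite qpochS lead_coefM unitrM IH /= -opprB lead_coefN unitrN.
by rewrite lead_coefDl ?lead_coefXn ?unitr1 // size_polyXn size_polyN size_poly1.
Qed.

(* The division defining [qbinom] is exact.                                    *)
Lemma qbinomK n m : (m <= n)%N ->
  qbinom n m * (qpoch m * qpoch (n - m)) = qpoch n.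
Proof.
move=> le_mn; have [g] := qpoch_dvd m (n - m); rewrite subnKC // => e.
rewrite /qbinom {1}e Pdiv.IdomainUnit.mulpK //.
by rewrite lead_coefM unitrM !lead_coef_qpoch.
Qed.

(* Polynomials in t and q are elements of {poly {poly int}}: t is the outer    *)
(* variable and q is the inner one.                                            *)
Definition tvar : {poly {poly int}} := 'X.

Definition qvar : {poly {poly int}} := 'X%:P.

Definition eulerA (n : nat) : {poly {poly int}} :=
  \sum_(s : 'S_n) tvar ^+ exc s * qvar ^+ (maj s - exc s).

Definition binomEulerA (n : nat) : {poly {poly int}} :=
  1 + tvar * \sum_(1 <= m < n.+1) (qbinom n m)%:P * eulerA m.

(* Main.v *)
Require Import Defs.
From mathcomp Require Import all_boot all_order all_fingroup all_algebra.
From mathcomp Require Import zify ring.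

(* Let D_n(t,q) be the contribution of derangements to A_n(t,q). Write [n,k] for
   the q-binomial coefficients and w(s) for the number of weak excedances of s.

   (1) maj - exc is the sum of the descents of s for the order on letters in
   which excedance letters precede all others. For these descents a fixed point
   behaves like an infinite letter shuffled into the derangement part of s, so
   that A_n = sum_k [n,k] D_k. Keeping track of whether n is fixed gives likewise
     sum_s t^w(s) q^(maj(s) + n [s(n) = n] - w(s)) = sum_k [n,k] t^(n-k) D_k.

   (2) If s' is obtained from s by subtracting 1 modulo n from all the values,
   then w(s') = exc(s) + 1 and maj(s') + n [s'(n) = n] = maj(s) + 1. Hence, for
   n >= 1, the left hand side above is t A_n.

   (3) Let h(z) = sum_n z^n / (q;q)_n and g(z) = h(tz), and let a, d, b be the
   similar generating functions of A_n, D_n and the q-binomial-Eulerian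
   polynomials. Then a = h d and 1 - t + t a = g d by (1) and (2), and
   b = h (1 - t + t a). Since h(qz) = (1 - z) h(z), it follows that
   b(z) - b(qz) = z b(z) (1 + t a(qz)), which is the recurrence. *)

Set Implicit Arguments.
Unset Strict Implicit.
Unset Printing Implicit Defensive.

Import GRing.Theory.

(** * Excedances, descents and the cyclic shift of values *)

(** Extending [s] by the identity to all of [nat] keeps it injective and lets neighbouring positions
    be compared without ordinals. *)
Definition pfun n (s : 'S_n) (i : nat) : nat :=
  oapp (fun j => s j : nat) i (insub i).

Lemma pfunE n (s : 'S_n) (j : 'I_n) : pfun s j = s j.
Proof. by rewrite /pfun valK. Qed.

Lemma pfun_lt n (s : 'S_n) i : i < n -> pfun s i < n.
Proof. by move=> lt_in; rewrite -[i]/(val (Ordinal lt_in)) pfunE. Qed.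

Lemma pfun_id n (s : 'S_n) i : n <= i -> pfun s i = i.
Proof. by move=> le_ni; rewrite /pfun insubF // ltnNge le_ni. Qed.

Lemma pfun_inj n (s : 'S_n) : injective (pfun s).
Proof.
move=> i j; have [lt_in|le_ni] := ltnP i n; have [lt_jn|le_nj] := ltnP j n.
- rewrite -[i]/(val (Ordinal lt_in)) -[j]/(val (Ordinal lt_jn)) !pfunE.
  by move/val_inj/perm_inj ->.
- by have := pfun_lt s lt_in; rewrite (pfun_id s le_nj) => + e; rewrite e; lia.
- by have := pfun_lt s lt_jn; rewrite (pfun_id s le_ni) => + e; rewrite -e; lia.
- by rewrite !pfun_id.
Qed.

Definition nexc n (f : nat -> nat) : nat := \sum_(0 <= i < n) (i < f i).

Definition nwexc n (f : nat -> nat) : nat := \sum_(0 <= i < n) (i <= f i).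

Definition wmaj n (d : nat -> bool) : nat := \sum_(0 <= i < n.-1) d i * i.+1.

Definition ddes (f : nat -> nat) (i : nat) : bool := f i.+1 < f i.

(* Descents for the order in which excedance letters come before all others. *)
Definition ddex (f : nat -> nat) (i : nat) : bool :=
  if i.+1 < f i.+1 then (f i <= i) || ddes f i else (f i <= i) && ddes f i.

Lemma letter_pfun n (s : 'S_n) i : i < n -> letter s i.+1 = (pfun s i).+1.
Proof.
by move=> lt_in; rewrite -[i]/(val (Ordinal lt_in)) letterE pfunE.
Qed.

Lemma exc_pfun n (s : 'S_n) : exc s = nexc n (pfun s).
Proof.
case: n s => [|n] s; first by rewrite /exc /nexc !big_geq.
rewrite /exc /nexc big_add1 [RHS]big_nat_recr //= big_mkcond /=.
have := pfun_lt s (ltnSn n); rewrite ltnS leqNgt => /negbTE ->; rewrite addn0.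
apply: eq_big_nat => i /andP[_ lt_in]; rewrite letter_pfun ?ltnS; last lia.
by case: ifP.
Qed.

Lemma maj_pfun n (s : 'S_n) : maj s = wmaj n (ddes (pfun s)).
Proof.
rewrite /maj /wmaj big_add1 big_mkcond /=.
apply: eq_big_nat => i /andP[_ lt_in]; rewrite !letter_pfun ?ltnS; try lia.
by rewrite /ddes; case: ifP; rewrite ?mul1n.
Qed.

(* The two kinds of descents at i differ by the difference of the indicators of
   excedances at i and i + 1; then sum by parts. *)
Lemma wmaj_ddex n (s : 'S_n) :
  wmaj n (ddex (pfun s)) + nexc n (pfun s) = wmaj n (ddes (pfun s)).
Proof.
case: n s => [|n] s; first by rewrite /wmaj /nexc !big_geq.
rewrite /wmaj /nexc /= big_nat_recr //= addnA.
set f := pfun s; have finj : injective f := @pfun_inj _ s.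
(* With the boundary term [n * (n < f n)] the identity holds for every injective [f], so induction
   on [n] applies; for a permutation that term vanishes. *)
suff: \sum_(0 <= i < n) ddex f i * i.+1 + \sum_(0 <= i < n) (i < f i) =
   \sum_(0 <= i < n) ddes f i * i.+1 + n * (n < f n).
  have : f n < n.+1 by apply: pfun_lt.
  by rewrite ltnS leqNgt => /negbTE -> ->; lia.
clearbody f; elim: n {s} => [|n IH]; first by rewrite !big_geq.
rewrite !big_nat_recr //=.
have : f n <> f n.+1 by move/finj; lia.
move: IH; rewrite /ddex /ddes; set S1 := bigop _ _ _; set S2 := bigop _ _ _.
set S3 := bigop _ _ _.
case: (ltnP n.+1 (f n.+1)); case: (ltnP n (f n));
  case: (ltnP (f n.+1) (f n)) => /=; lia.
Qed.

Lemma maj_exc n (s : 'S_n) : maj s - exc s = wmaj n (ddex (pfun s)).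
Proof. by rewrite maj_pfun exc_pfun -wmaj_ddex addnK. Qed.

Section Shift.
Variable n : nat.
(** In a product the left factor acts first, so the cyclic predecessor changes the values and not
    the positions. *)
Definition shiftp (s : 'S_n.+1) : 'S_n.+1 := (s * perm (@ord_pred_inj n.+1))%g.

Lemma shiftp_bij : bijective shiftp.
Proof.
exists (fun s => (s * (perm (@ord_pred_inj n.+1))^-1)%g) => s.
  by rewrite /shiftp mulgK.
by rewrite /shiftp mulgKV.
Qed.

Lemma pfun_shiftp s i : i < n.+1 ->
  pfun (shiftp s) i = if pfun s i == 0 then n else (pfun s i).-1.
Proof.
move=> lt_in; rewrite -[i]/(val (Ordinal lt_in)) !pfunE permM permE /=.
case: (s _) => -[|j] /= lt_j; first by rewrite modn_small.
by rewrite modnDr modn_small // ltnW.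
Qed.

Lemma sum_pfun_eq0 (s : 'S_n.+1) : \sum_(0 <= i < n.+1) (pfun s i == 0) = 1.
Proof.
rewrite big_mkord (bigD1 ((s^-1)%g ord0)) //= pfunE permKV eqxx big1 ?addn0 //.
move=> i ne_i; rewrite pfunE; case: eqP => // /eqP si0; case/negP: ne_i.
by apply/eqP; apply: (@perm_inj _ s); rewrite permKV; apply/val_inj/eqP.
Qed.

(** A position is a weak excedance after the shift iff it was an excedance or carried the value 0,
    which becomes the largest value; just one position carries 0. *)
Lemma nwexc_shiftp s : nwexc n.+1 (pfun (shiftp s)) = (exc s).+1.
Proof.
rewrite exc_pfun -[RHS]addn1 -[X in _ = _ + X](sum_pfun_eq0 s).
rewrite /nwexc /nexc -big_split /=.
apply: eq_big_nat => i /andP[_ lt_in]; rewrite pfun_shiftp //.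
by case: (pfun s i) => [|j] /=; lia.
Qed.

(** Only comparisons with the value 0 change: the descent just before it, if any, moves one place to
    the right. If 0 stands last, the added term supplies the descent that would fall off the end. *)
Lemma maj_shiftp s :
  maj (shiftp s) + n.+1 * (pfun (shiftp s) n == n) = (maj s).+1.
Proof.
have fl i : i < n.+1 -> pfun s i < n.+1 by apply: pfun_lt.
rewrite !maj_pfun /wmaj /= -[RHS]addn1 -[X in _ = _ + X](sum_pfun_eq0 s).
have -> : (pfun (shiftp s) n == n) = (pfun s n == 0).
  by rewrite pfun_shiftp //; have := fl n (ltnSn n);
    case: (pfun s n) => [|j] /=; lia.
(* Prefix form for the induction: [m.+1 * (pfun s m == 0)] anticipates the descent at [m] of the
   shifted word, which the sum does not yet contain. *)
suff H m : m <= n -> \sum_(0 <= i < m) ddes (pfun (shiftp s)) i * i.+1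
    + m.+1 * (pfun s m == 0)
  = \sum_(0 <= i < m) ddes (pfun s) i * i.+1
    + \sum_(0 <= i < m.+1) (pfun s i == 0) by rewrite H.
elim: m => [|m IH] le_mn; first by rewrite big_nat1 !big_geq // mul1n.
rewrite big_nat_recr //= [in RHS]big_nat_recr //=.
rewrite [X in _ = _ + X]big_nat_recr //=.
have := IH (ltnW le_mn); rewrite /ddes !pfun_shiftp; try lia.
have := fl m (leqW le_mn); have := fl m.+1 le_mn.
have : pfun s m <> pfun s m.+1 by move/pfun_inj; lia.
set S1 := bigop _ _ _; set S2 := bigop _ _ _; set S3 := bigop _ _ _.
by case: (pfun s m) => [|a]; case: (pfun s m.+1) => [|b] /=; lia.
Qed.

End Shift.

(** * Permutations with a given set of fixed points *)

(** Descents of a shuffle of a word with descents [D] and copies of an infinite letter, where [m]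
    marks the letters of the word: an infinite letter makes a descent exactly when a letter of the
    word follows it. *)
Definition sdes (D : nat -> bool) (m : bitseq) (i : nat) : bool :=
  nth false m i.+1 && (nth false m i ==> D (count id (take i m))).

Definition smaj D (m : bitseq) : nat := wmaj (size m) (sdes D m).

Lemma smaj_rcons D m x y :
  smaj D (rcons (rcons m x) y) =
  smaj D (rcons m x) + (y && (x ==> D (count id m))) * (size m).+1.
Proof.
rewrite /smaj /wmaj !size_rcons /= big_nat_recr //=; congr (_ + _ * _).
  apply: eq_big_nat => i /andP[_ lt_im].
  have ltx : i.+1 < size (rcons m x) by rewrite size_rcons.
  have ltx' := ltnW ltx.
  rewrite /sdes -(cats1 (rcons m x)) !nth_cat ltx ltx'.
  by rewrite take_cat ltx'.
rewrite /sdes nth_rcons size_rcons ltnn eqxx -(cats1 (rcons m x)) !nth_cat.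
rewrite size_rcons ltnSn nth_rcons ltnn eqxx.
by rewrite take_cat size_rcons ltnSn -cats1 take_cat ltnn subnn cats0.
Qed.

Lemma smaj_seq1 D x : smaj D [:: x] = 0.
Proof. by rewrite /smaj /wmaj big_geq. Qed.

Lemma smaj_rcons_false D m : smaj D (rcons m false) = smaj D m.
Proof.
case/lastP: m => [|m x]; first by rewrite smaj_seq1 /smaj /wmaj big_geq.
by rewrite smaj_rcons addn0.
Qed.

Definition positions (m : bitseq) : seq nat :=
  [seq i <- iota 0 (size m) | nth false m i].

Definition rank (m : bitseq) (i : nat) : nat := count id (take i m).

Lemma mem_positions m i : (i \in positions m) = nth false m i.
Proof.
rewrite mem_filter mem_iota leq0n add0n.
by case: ltnP => [_|le_mi]; rewrite ?andbT // nth_default.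
Qed.

Lemma positions_uniq m : uniq (positions m).
Proof. exact/filter_uniq/iota_uniq. Qed.

Lemma positions_rcons m x : positions (rcons m x) = positions m ++ nseq x (size m).
Proof.
rewrite /positions size_rcons -addn1 iotaD filter_cat add0n /= nth_rcons ltnn eqxx.
congr (_ ++ _); last by case: x.
by apply: eq_in_filter => i; rewrite mem_iota nth_rcons add0n /= => ->.
Qed.

Lemma size_positions m : size (positions m) = count id m.
Proof.
elim/last_ind: m => // m x IH.
by rewrite positions_rcons size_cat size_nseq IH -cats1 count_cat /= addn0.
Qed.

Lemma rankS m i : rank m i.+1 = rank m i + nth false m i.
Proof.
rewrite /rank; have [lt_im|le_mi] := ltnP i (size m).
  by rewrite (take_nth false) // -cats1 count_cat /= addn0.
by rewrite !take_oversize ?nth_default ?addn0 //; lia.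
Qed.

Lemma leq_rank m : {homo rank m : i j / i <= j}.
Proof.
move=> i j; elim: j => [|j IH]; first by rewrite leqn0 => /eqP ->.
by rewrite leq_eqVlt => /predU1P[->//|/IH]; rewrite rankS; lia.
Qed.

Lemma ltn_rank m i j : nth false m i -> nth false m j ->
  (rank m i < rank m j) = (i < j).
Proof.
move=> mi mj; have [lt_ij|le_ji] := ltnP i j.
  by rewrite (leq_trans _ (leq_rank m lt_ij)) // rankS mi addn1.
by apply/negbTE; rewrite -leqNgt leq_rank.
Qed.

Lemma rank_lt m i : nth false m i -> rank m i < count id m.
Proof.
move=> mi; have -> : count id m = rank m (size m) by rewrite /rank take_size.
have lt_im : i < size m.
  by rewrite ltnNge; apply: contraL mi => /(nth_default _) ->.
by rewrite (leq_trans _ (leq_rank m lt_im)) // rankS mi addn1.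
Qed.

Lemma nth_positions_rank m i :
  nth false m i -> nth 0 (positions m) (rank m i) = i.
Proof.
elim/last_ind: m => [|m x IH]; first by rewrite nth_nil.
rewrite nth_rcons positions_rcons nth_cat size_positions /rank -cats1.
case: (ltngtP i (size m)) => // [lt_im|->].
  by move=> mi; rewrite (takel_cat _ (ltnW lt_im)) -/(rank m i) rank_lt // IH.
by move=> ->; rewrite takel_cat // take_size ltnn subnn.
Qed.

Lemma rank_nth_positions m j :
  j < count id m -> rank m (nth 0 (positions m) j) = j.
Proof.
rewrite -size_positions => lt_j; have mj : nth false m (nth 0 (positions m) j).
  by rewrite -mem_positions mem_nth.
apply/eqP; rewrite -(nth_uniq 0 _ lt_j (positions_uniq m)) ?nth_positions_rank //.
by rewrite size_positions rank_lt.
Qed.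

Lemma nth_nth_positions m j :
  j < count id m -> nth false m (nth 0 (positions m) j).
Proof. by move=> lt_j; rewrite -mem_positions mem_nth ?size_positions. Qed.

(** Conjugation by the order isomorphism [rank] from the marked positions to an initial segment;
    unmarked positions become fixed points. *)
Definition extf (m : bitseq) (a : nat -> nat) (i : nat) : nat :=
  if nth false m i then nth 0 (positions m) (a (rank m i)) else i.

Definition derang n (s : 'S_n) : bool := [forall i, s i != i].

Definition nonfix n (s : 'S_n) : n.-tuple bool := [tuple s i != i | i < n].

Lemma nth_nonfix n (s : 'S_n) i : nth false (nonfix s) i = (pfun s i != i).
Proof.
have [lt_in|le_ni] := ltnP i n; last first.
  by rewrite nth_default ?size_tuple // pfun_id ?eqxx.
by rewrite -[i]/(val (Ordinal lt_in)) -tnth_nth tnth_mktuple pfunE.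
Qed.

Lemma derangP n (s : 'S_n) :
  reflect (forall i, i < n -> pfun s i <> i) (derang s).
Proof.
apply: (iffP forallP) => [der i lt_in|der i].
  rewrite -[i]/(val (Ordinal lt_in)) pfunE => /val_inj.
  exact/eqP/der.
by apply/eqP => e; apply: (der i); rewrite // pfunE e.
Qed.

Section Extension.
Variables (n : nat) (m : n.-tuple bool).
Let k := count id m.

Lemma marked_lt i : nth false m i -> i < n.
Proof.
by apply: contraLR; rewrite -leqNgt => ?; rewrite nth_default ?size_tuple.
Qed.

Lemma marked_extf (s : 'S_k) i : nth false m (extf m (pfun s) i) = nth false m i.
Proof.
rewrite /extf; case: ifP => // mi.
by rewrite nth_nth_positions // pfun_lt // rank_lt.
Qed.

Lemma rank_extf (s : 'S_k) i : nth false m i ->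
  rank m (extf m (pfun s) i) = pfun s (rank m i).
Proof. by move=> mi; rewrite /extf mi rank_nth_positions // pfun_lt // rank_lt. Qed.

Lemma extf_lt (s : 'S_k) i : i < n -> extf m (pfun s) i < n.
Proof.
move=> lt_in; case mi: (nth false m i); last by rewrite /extf mi.
by apply: marked_lt; rewrite marked_extf.
Qed.

Lemma extf_inj (s : 'S_k) : injective (extf m (pfun s)).
Proof.
move=> i j e; have := marked_extf s i; have := marked_extf s j.
rewrite e => ->; case mi: (nth false m i) => mj; last first.
  by move: e; rewrite /extf mi mj.
rewrite -(nth_positions_rank mi) -(nth_positions_rank mj); congr nth.
by apply: (@pfun_inj _ s); rewrite -!rank_extf // e.
Qed.

Definition extp_fun (s : 'S_k) (i : 'I_n) : 'I_n :=
  Ordinal (extf_lt s (ltn_ord i)).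

Lemma extp_fun_inj (s : 'S_k) : injective (extp_fun s).
Proof. by move=> i j /(congr1 val) /= /extf_inj /val_inj. Qed.

Definition extp (s : 'S_k) : 'S_n := perm (@extp_fun_inj s).

Lemma pfun_extp s i : pfun (extp s) i = extf m (pfun s) i.
Proof.
have [lt_in|le_ni] := ltnP i n.
  by rewrite -[i]/(val (Ordinal lt_in)) pfunE permE.
by rewrite pfun_id // /extf nth_default ?size_tuple.
Qed.

Lemma extp_inj : injective extp.
Proof.
move=> s u e; apply/permP => j; apply: val_inj; rewrite /= -!pfunE.
have lt_j : j < count id m := ltn_ord j.
have mj := nth_nth_positions lt_j.
by rewrite -(rank_nth_positions lt_j) -!rank_extf // -!pfun_extp e.
Qed.

Lemma nonfix_extp s : (nonfix (extp s) == m) = derang s.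
Proof.
apply/eqP/derangP => [e j lt_jk sj|der].
  have mj := nth_nth_positions lt_jk; have := mj.
  rewrite -{1}e nth_nonfix pfun_extp.
  by rewrite /extf mj rank_nth_positions // sj eqxx.
apply: val_inj; apply: (@eq_from_nth _ false); rewrite ?size_tuple // => i _.
rewrite nth_nonfix pfun_extp.
case mi: (nth false m i); last by rewrite /extf mi eqxx.
apply/eqP => /(congr1 (rank m)); rewrite rank_extf //.
exact/der/rank_lt.
Qed.

(** An injective map sends moved points to moved points, so [s] permutes the marked positions, and
    reading it through [rank] gives [u]. *)
Lemma extp_surj (s : 'S_n) : nonfix s = m -> exists u, extp u = s.
Proof.
move=> e; have ms i : nth false m i = (pfun s i != i) by rewrite -e nth_nonfix.
have mss i : nth false m (pfun s i) = nth false m i.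
  by rewrite !ms (inj_eq (@pfun_inj _ s)).
have lt_u (j : 'I_k) : rank m (pfun s (nth 0 (positions m) j)) < k.
  by rewrite rank_lt // mss nth_nth_positions.
have u_inj : injective (fun j => Ordinal (lt_u j)).
  move=> i j /(congr1 val) /= /(congr1 (nth 0 (positions m))).
  rewrite !nth_positions_rank ?mss ?nth_nth_positions //.
  move/pfun_inj/eqP; rewrite nth_uniq ?size_positions ?positions_uniq //.
  by move/eqP/val_inj.
exists (perm u_inj); apply/permP => i; apply: val_inj.
rewrite /= -!pfunE pfun_extp /extf.
case mi: (nth false m i); last by apply/esym/eqP; rewrite -[_ == _]negbK -ms mi.
have lt_ik : rank m i < k := rank_lt mi.
rewrite -[rank m i]/(val (Ordinal lt_ik)) (pfunE (perm u_inj)) permE /=.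
rewrite nth_positions_rank.
  by rewrite nth_positions_rank.
by rewrite mss nth_positions_rank.
Qed.

End Extension.

Section ExtensionStatistics.
Variables (n : nat) (m : n.-tuple bool).
Let k := count id m.
Variable u : 'S_k.
Let f := pfun (extp u).

Lemma ltn_extp i j : nth false m i -> nth false m j ->
  (i < f j) = (rank m i < pfun u (rank m j)).
Proof.
move=> mi mj; rewrite /f pfun_extp -rank_extf // ltn_rank //.
by rewrite marked_extf.
Qed.

Lemma ltn_extp2 i j : nth false m i -> nth false m j ->
  (f i < f j) = (pfun u (rank m i) < pfun u (rank m j)).
Proof.
by move=> mi mj; rewrite /f !pfun_extp -!rank_extf // ltn_rank ?marked_extf.
Qed.

Lemma extp_unmarked i : nth false m i = false -> f i = i.
Proof. by move=> mi; rewrite /f pfun_extp /extf mi. Qed.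

(** Between marked neighbours all comparisons survive the passage to ranks. A fixed point is not an
    excedance letter, so nothing descends to it. From a fixed point [i] to a marked [i.+1] there is
    always a descent, since [f i.+1] is neither [i] (unmarked) nor [i.+1] ([u] is a derangement). *)
Lemma ddex_extp i : derang u -> ddex f i = sdes (ddex (pfun u)) m i.
Proof.
move=> /derangP der; rewrite /sdes -/(rank m i).
have marked j : nth false m j -> nth false m (f j).
  by rewrite /f pfun_extp marked_extf.
case mi: (nth false m i); case mi1: (nth false m i.+1) => /=.
- have rS : rank m i.+1 = (rank m i).+1 by rewrite rankS mi addn1.
  have le_i : (f i <= i) = (pfun u (rank m i) <= rank m i).
    by rewrite leqNgt ltn_extp // -leqNgt.
  by rewrite /ddex /ddes le_i ltn_extp // ltn_extp2 // rS.
- by rewrite /ddex /ddes (extp_unmarked mi1) ltnn; case: ltngtP => //=; lia.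
- have : f i.+1 <> i by move=> e; move: (marked _ mi1); rewrite e mi.
  have : f i.+1 <> i.+1.
    move=> /(congr1 (rank m)); rewrite /f pfun_extp rank_extf //.
    exact/der/rank_lt.
  rewrite /ddex /ddes (extp_unmarked mi) leqnn /=; move: (f i.+1) => x.
  by case: ifP => //; lia.
- rewrite /ddex /ddes (extp_unmarked mi) (extp_unmarked mi1) ltnn leqnn /=.
  by rewrite ltnNge leqnSn.
Qed.

Lemma smaj_extp : derang u -> wmaj n (ddex f) = smaj (ddex (pfun u)) m.
Proof.
move=> der; rewrite /smaj size_tuple; apply: eq_bigr => i _.
by rewrite ddex_extp.
Qed.

Lemma nexc_extp : nexc n f = nexc k (pfun u).
Proof.
have -> : nexc n f = \sum_(i <- positions m) (i < f i).
  rewrite big_filter size_tuple /nexc big_mkcond /index_iota subn0.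
  rewrite [RHS]big_mkcond; apply: eq_bigr => i _ /=.
  by case mi: (nth _ _ _); rewrite ?(extp_unmarked mi) ?ltnn.
rewrite (big_nth 0) size_positions; apply: eq_big_nat => j /andP[_ lt_jk].
by rewrite ltn_extp ?nth_nth_positions // rank_nth_positions.
Qed.

Lemma nwexc_extp : derang u -> nwexc n f = nexc k (pfun u) + (n - k).
Proof.
move=> /derangP der; rewrite -nexc_extp.
have -> : n - k = \sum_(0 <= i < n) ~~ nth false m i.
  have := count_predC id m; rewrite size_tuple => {1}<-; rewrite addKn.
  rewrite -sum1_count (big_nth false) size_tuple big_mkcond.
  by apply: eq_bigr => i _ /=; case: ifP.
rewrite -big_split /=; apply: eq_bigr => i _.
case mi: (nth _ _ _); last by rewrite extp_unmarked //; lia.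
have : f i <> i; last by lia.
move/(congr1 (rank m)); rewrite /f pfun_extp rank_extf //.
exact/der/rank_lt.
Qed.

End ExtensionStatistics.

(** The major index in which a fixed last position also counts as a descent; on shifted permutations
    it is [maj] of the original plus 1. *)
Definition wstat n (s : 'S_n) : nat := maj s + n * (pfun s n.-1 == n.-1).

(** Every permutation is a shift, and for shifts this is [exc_le_maj]. *)
Lemma nwexc_wstat n (s : 'S_n.+1) : nwexc n.+1 (pfun s) <= wstat s.
Proof.
have [h _ hK] := shiftp_bij n.
by rewrite -(hK s) /wstat nwexc_shiftp maj_shiftp ltnS exc_le_maj.
Qed.

Lemma wstat_extp n (m : n.-tuple bool) (u : 'S_(count id m)) : derang u ->
  wstat (extp u) =
  smaj (ddex (pfun u)) m + n * ~~ nth false m n.-1 + nexc (count id m) (pfun u).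
Proof.
move=> der; rewrite /wstat maj_pfun -wmaj_ddex smaj_extp // nexc_extp addnAC.
congr (_ + _ * _ + _); rewrite -[_ == _]negbK -nth_nonfix.
by move: der; rewrite -nonfix_extp => /eqP ->.
Qed.

(** This is [nwexc_wstat] for [extp u] with the excedances cancelled. The separate [k] allows its
    use inside a sum over all masks with [k] marks. *)
Lemma leq_smaj n (m : n.+1.-tuple bool) k (u : 'S_k) :
  count id m = k -> derang u ->
  n.+1 - k <= smaj (ddex (pfun u)) m + n.+1 * ~~ nth false m n.
Proof.
move=> e; move: u; rewrite -{}e => u der.
have := nwexc_wstat (extp u); rewrite nwexc_extp // wstat_extp //.
by rewrite addnC leq_add2r.
Qed.

Local Open Scope ring_scope.

(** * Shuffles and q-binomial coefficients *)

Lemma sum_tuple_rcons (R : nmodType) n (F : bitseq -> R) (P : pred bitseq) :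
  \sum_(m : n.+1.-tuple bool | P m) F m =
  \sum_(m : n.-tuple bool | P (rcons m true)) F (rcons m true)
  + \sum_(m : n.-tuple bool | P (rcons m false)) F (rcons m false).
Proof.
pose h (p : n.-tuple bool * bool) : n.+1.-tuple bool :=
  [tuple of rcons p.1 p.2].
have hbij : bijective h.
  apply: inj_card_bij; last by rewrite card_prod !card_tuple card_bool expnSr.
  by move=> [m x] [m' x'] /(congr1 val) /= /rcons_inj[/val_inj -> ->].
rewrite (reindex h) /=; last exact: onW_bij.
rewrite (eq_bigr (fun p : n.-tuple bool * bool => F (rcons p.1 p.2))) //.
rewrite (eq_bigl (fun p : n.-tuple bool * bool =>
  xpredT p.1 && P (rcons p.1 p.2))) //.
rewrite -(pair_big_dep xpredT (fun (m : n.-tuple bool) x => P (rcons m x))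
  (fun m x => F (rcons m x))) /=.
rewrite [X in X + _]big_mkcond [X in _ + X]big_mkcond -big_split /=.
by apply: eq_bigr => m _; rewrite big_mkcond big_bool.
Qed.

(** The q-binomial coefficient by its Pascal rule, free of division and hence available for any
    [q]. *)
Fixpoint gauss (R : pzSemiRingType) (q : R) (n k : nat) : R :=
  match n, k with
  | _, 0 => 1
  | 0, _.+1 => 0
  | n.+1, k.+1 => gauss q n k + q ^+ k.+1 * gauss q n k.+1
  end.

Section Gauss.
Variables (R : comPzRingType) (q : R).
Local Notation gauss := (gauss q).

Lemma gaussn0 n : gauss n 0 = 1. Proof. by case: n. Qed.

Lemma gaussS n k :
  gauss n.+1 k.+1 = gauss n k + q ^+ k.+1 * gauss n k.+1.
Proof. by []. Qed.

Lemma gauss_small n k : (n < k)%N -> gauss n k = 0.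
Proof.
elim: n k => [|n IH] [|k] //= lt_nk.
by rewrite !IH ?mulr0 ?addr0 //; lia.
Qed.

Lemma gaussnn n : gauss n n = 1.
Proof. by elim: n => //= n ->; rewrite gauss_small // mulr0 addr0. Qed.

Lemma gaussSr n k : (k <= n)%N ->
  gauss n.+1 k.+1 = gauss n k.+1 + q ^+ (n - k) * gauss n k.
Proof.
elim: n k => [|n IH] [|k] // le_kn.
- by rewrite /= mulr0 mul1r addr0 add0r.
- rewrite (gaussS n.+1) [in LHS]IH // (gaussS n) !gaussn0 !subn0 expr1.
  by rewrite (exprS q n); ring.
have [lt_kn|le_nk] := ltnP k n; last first.
  have -> : k = n by lia.
  by rewrite !gaussnn subnn gauss_small // add0r mul1r.
rewrite (gaussS n.+1) [in LHS](IH k) // [in LHS](IH k.+1) // subSS.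
rewrite (gaussS n k.+1) (gaussS n k).
have -> : (n - k = (n - k.+1).+1)%N by lia.
rewrite !exprS; ring.
Qed.

(* A word with descent set D and k letters is shuffled with copies of a letter
   larger than all others; the masks mark the positions of the original letters. *)
Lemma sum_smaj_rcons_true D (n k : nat) :
  \sum_(m : n.-tuple bool | count id m == k) q ^+ smaj D (rcons m true)
    = q ^+ (wmaj k.+1 D + (n - k)) * gauss n k
  /\ \sum_(m : n.-tuple bool | count id m == k) q ^+ smaj D m
    = q ^+ wmaj k D * gauss n k.
Proof.
(* The two sums need a joint induction: in the second one, masks that end in an original letter lead
   to the first. *)
elim: n k => [|n IH] k.
  have sum0 (F : bitseq -> R) : \sum_(m : 0.-tuple bool | count id m == k) F m
      = if k == 0%N then F [::] else 0.
    rewrite big_mkcond (eq_bigr (fun=> if k == 0%N then F [::] else 0)).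
      by rewrite big_const card_tuple /= addr0.
    by move=> m _; rewrite tuple0 eq_sym.
  split; [rewrite (sum0 (fun m => q ^+ smaj D (rcons m true)))
         |rewrite (sum0 (fun m => q ^+ smaj D m))].
    by case: k {sum0} => [|k] /=; rewrite ?mulr0 // smaj_seq1 /wmaj big_geq ?mulr1.
  by case: k {sum0} => [|k] /=; rewrite ?mulr0 // /smaj /wmaj !big_geq ?mulr1.
(* The boolean [x] is the letter appended to the mask. Appending an infinite letter leaves [smaj]
   unchanged, so [x = false] serves the second sum. *)
have sumF x : \sum_(m : n.-tuple bool | count id (rcons m false) == k)
      q ^+ smaj D (rcons (rcons m false) x) =
      q ^+ (x * n.+1 + wmaj k D) * gauss n k.
  rewrite exprD -mulrA -(IH k).2 mulr_sumr; apply: eq_big => m.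
    by rewrite -cats1 count_cat /= !addn0.
  by move=> _; rewrite smaj_rcons smaj_rcons_false andbT size_tuple addnC exprD.
have sumT x : \sum_(m : n.-tuple bool | count id (rcons m true) == k)
      q ^+ smaj D (rcons (rcons m true) x) =
    if k is k'.+1 then
      q ^+ ((x && D k') * n.+1 + (wmaj k D + (n - k'))) * gauss n k' else 0.
  case: k {sumF} => [|k].
    by rewrite big_pred0 // => m; rewrite -cats1 count_cat /= addn0 addn1.
  rewrite exprD -mulrA -(IH k).1 mulr_sumr; apply: eq_big => m.
    by rewrite -cats1 count_cat /= addn0 addn1 eqSS.
  rewrite -cats1 count_cat /= addn0 addn1 eqSS => /eqP e.
  by rewrite cats1 smaj_rcons e size_tuple addnC exprD.
have E1 := @sum_tuple_rcons R n (fun m => q ^+ smaj D (rcons m true))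
  (fun m => count id m == k).
have E2 := @sum_tuple_rcons R n (fun m => q ^+ smaj D (rcons m false))
  (fun m => count id m == k).
have E0 : \sum_(m : n.+1.-tuple bool | count id m == k) q ^+ smaj D m =
    \sum_(m : n.+1.-tuple bool | count id m == k) q ^+ smaj D (rcons m false).
  by apply: eq_bigr => m _; rewrite smaj_rcons_false.
rewrite {}E0 {}E1 {}E2 !{}sumF.
case: k sumT => [|k] sumT; rewrite !{}sumT !mul0n !mul1n !add0n.
  by rewrite !gaussn0 subn0 /wmaj !big_geq // !add0r !mulr1 addn0.
rewrite subSS.
have wmajS : wmaj k.+2 D = (wmaj k.+1 D + D k * k.+1)%N.
  by rewrite /wmaj /= big_nat_recr.
have [le_kn|lt_nk] := leqP k n; last first.
  by rewrite !gauss_small //; try lia; rewrite !mulr0 addr0.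
split; last first.
  by rewrite gaussSr // exprD; ring.
(* After an infinite letter the new letter always makes a descent, after an original one iff [D k]
   holds; the two values of [D k] call for the two Pascal rules. *)
rewrite {}wmajS; case: (D k); rewrite ?mul1n ?mul0n ?addn0 ?add0n.
  rewrite gaussSr //.
  have -> : (wmaj k.+1 D + k.+1 + (n - k) = n.+1 + wmaj k.+1 D)%N by lia.
  by rewrite !exprD; ring.
rewrite gaussS.
have -> : (n.+1 + wmaj k.+1 D = wmaj k.+1 D + (n - k) + k.+1)%N by lia.
by rewrite !exprD; ring.
Qed.
End Gauss.

(** [extp] is a bijection from the derangements on the marks of [m] onto the permutations moving
    exactly the marked points; the default in [h] is never met on its image. *)
Lemma sum_extp (V : nmodType) n (m : n.-tuple bool) (F : 'S_n -> V) :
  \sum_(s : 'S_n | nonfix s == m) F s =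
  \sum_(u : 'S_(count id m) | derang u) F (extp u).
Proof.
pose h s : 'S_(count id m) := odflt 1%g [pick u | extp u == s].
have extpK : cancel (@extp n m) h.
  move=> u; rewrite /h; case: pickP => [v /eqP/extp_inj //|/(_ u)].
  by rewrite eqxx.
rewrite (reindex_onto (@extp n m) h) /=; last first.
  by move=> s /eqP /extp_surj[u <-]; rewrite extpK.
by apply: eq_bigl => u; rewrite nonfix_extp extpK eqxx andbT.
Qed.

(** * Expansions of Eulerian sums over derangements *)

Section Sums.
Variables (R : idomainType) (t q : R).

Definition eulersum n (P : pred 'S_n) : R :=
  \sum_(s : 'S_n | P s) t ^+ exc s * q ^+ (maj s - exc s).

(** Permutations are sorted by mask and masks by number of marks. As [G] takes [u] and the mask
    independently, the type of [u] no longer depends on the mask and the sums can be exchanged. *)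
Lemma sum_nonfix (V : nmodType) n (F : 'S_n -> V)
    (G : forall k, 'S_k -> bitseq -> V) :
  (forall (m : n.-tuple bool) (u : 'S_(count id m)), derang u ->
     F (extp u) = G _ u m) ->
  \sum_s F s = \sum_(0 <= k < n.+1) \sum_(u : 'S_k | derang u)
     \sum_(m : n.-tuple bool | count id m == k) G k u m.
Proof.
move=> FG; rewrite (partition_big (@nonfix n) xpredT) //=.
have lt_count (m : n.-tuple bool) : (count id m < n.+1)%N.
  by rewrite ltnS -[X in (_ <= X)%N](size_tuple m) count_size.
rewrite (partition_big (fun m => Ordinal (lt_count m)) xpredT) //= big_mkord.
apply: eq_bigr => k _; rewrite exchange_big; apply: eq_bigr => m /= /eqP[<-].
by rewrite sum_extp; apply: eq_bigr => u der; rewrite FG.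
Qed.

Lemma eulersum_derang n :
  eulersum (n := n) xpredT =
  \sum_(0 <= k < n.+1) gauss q n k * eulersum (n := k) (@derang k).
Proof.
rewrite /eulersum (@sum_nonfix _ _ _ (fun k u m =>
  t ^+ exc u * q ^+ smaj (ddex (pfun u)) m)); last first.
  by move=> m u der; rewrite maj_exc smaj_extp // exc_pfun nexc_extp -exc_pfun.
apply: eq_bigr => k _; rewrite mulr_sumr; apply: eq_bigr => u _.
by rewrite -mulr_sumr (sum_smaj_rcons_true _ _ _ _).2 maj_exc; ring.
Qed.

Hypothesis q0 : q != 0.

Lemma sum_smaj_wstat n k (u : 'S_k) : derang u -> (k <= n.+1)%N ->
  \sum_(m : n.+1.-tuple bool | count id m == k)
     q ^+ (smaj (ddex (pfun u)) m + n.+1 * ~~ nth false m n - (n.+1 - k))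
  = q ^+ wmaj k (ddex (pfun u)) * gauss q n.+1 k.
Proof.
(* Multiplying by this power of [q] removes the truncated subtraction, exact by [leq_smaj]; then the
   masks are split by their last letter. *)
move=> der le_kn; apply: (mulfI (expf_neq0 (n.+1 - k) q0)).
rewrite mulr_sumr; under eq_bigr => m /eqP e
  do rewrite -exprD subnKC ?(leq_smaj e der) //.
set D := ddex _.
rewrite (@sum_tuple_rcons R n
  (fun m => q ^+ (smaj D m + n.+1 * ~~ nth false m n))
  (fun m => count id m == k)).
have -> : \sum_(m : n.-tuple bool | count id (rcons m false) == k)
      q ^+ (smaj D (rcons m false) + n.+1 * ~~ nth false (rcons m false) n)
    = q ^+ (n.+1 + wmaj k D) * gauss q n k.
  rewrite exprD -mulrA -(sum_smaj_rcons_true q D n k).2 mulr_sumr.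
  apply: eq_big => m; first by rewrite -cats1 count_cat /= !addn0.
  move=> _; rewrite smaj_rcons_false nth_rcons size_tuple ltnn eqxx muln1.
  by rewrite addnC exprD.
have -> : \sum_(m : n.-tuple bool | count id (rcons m true) == k)
      q ^+ (smaj D (rcons m true) + n.+1 * ~~ nth false (rcons m true) n)
    = \sum_(m : n.-tuple bool | (count id m).+1 == k)
        q ^+ smaj D (rcons m true).
  apply: eq_big => m; first by rewrite -cats1 count_cat /= addn0 addn1.
  by move=> _; rewrite nth_rcons size_tuple ltnn eqxx muln0 addn0.
case: k u {der} @D le_kn => [|k] u D le_kn.
  by rewrite big_pred0 // !gaussn0 subn0 add0r exprD; ring.
under eq_bigl => m do rewrite eqSS.
rewrite (sum_smaj_rcons_true _ _ _ _).1 subSS gaussS.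
rewrite (_ : (n.+1 + wmaj k.+1 D = wmaj k.+1 D + (n - k) + k.+1)%N); last lia.
by rewrite !exprD; ring.
Qed.

Lemma eulersum_derang_shift n :
  t * eulersum (n := n.+1) xpredT =
  \sum_(0 <= k < n.+2) gauss q n.+1 k * t ^+ (n.+1 - k)
    * eulersum (n := k) (@derang k).
Proof.
pose F (s : 'S_n.+1) :=
  t ^+ nwexc n.+1 (pfun s) * q ^+ (wstat s - nwexc n.+1 (pfun s)).
(* Reindexed by the shift, the exponent of [t] is [exc s + 1], while in that of [q] the two
   increments by 1 cancel. *)
transitivity (\sum_s F s).
  rewrite (reindex (@shiftp n)) /=; last exact/onW_bij/shiftp_bij.
  rewrite mulr_sumr; apply: eq_bigr => s _.
  by rewrite /F nwexc_shiftp /wstat maj_shiftp subSS exprS mulrA.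
rewrite (@sum_nonfix _ _ _ (fun k u m => t ^+ (n.+1 - k) * t ^+ exc u *
  q ^+ (smaj (ddex (pfun u)) m + n.+1 * ~~ nth false m n - (n.+1 - k)))); last first.
  move=> m u der; rewrite /F nwexc_extp // wstat_extp // exc_pfun exprD.
  by rewrite subnDA addnK; ring.
apply: eq_big_nat => k /andP[_ lt_kn]; rewrite mulr_sumr.
apply: eq_bigr => u der; rewrite -mulr_sumr sum_smaj_wstat // maj_exc; ring.
Qed.

End Sums.

(** * Truncated q-exponential generating functions *)

(** Primed letters are the series at qz. The factor [1 - t] stays on both sides because it is not
    assumed invertible here. *)
Lemma qdiff_identity (R : comPzRingType)
    (t z h g d a w b h' g' d' a' w' b' : R) :
  a = h * d -> w = g * d -> w = 1 - t + t * a -> b = h * w ->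
  a' = h' * d' -> w' = g' * d' -> w' = 1 - t + t * a' -> b' = h' * w' ->
  h' = (1 - z) * h -> g' = (1 - t * z) * g ->
  (1 - t) * (b - b') = (1 - t) * (z * (b * (1 + t * a'))).
Proof.
move=> ea ew E eb ea' ew' E' eb' eh eg.
move: E E'; rewrite {}eb {}eb' {}ew {}ew' {}ea {}ea' {}eh {}eg => E E'.
have {}E : 1 - t = g * d - t * (h * d) by rewrite E addrK.
have {}E' : 1 - t = (1 - t * z) * g * d' - t * ((1 - z) * h * d').
  by rewrite E' addrK.
(* In the bracket each [1 - t] is replaced by its expression at the other argument, so that the
   terms in [g * d * d'] cancel. *)
rewrite [LHS](_ : _ =
  h * g * (1 - z) * (d * (1 - t) - (1 - t * z) * d' * (1 - t))
  + (1 - t) * (z * h * g * d)); last by ring.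
rewrite [X in d * X]E' [X in _ * d' * X]E; ring.
Qed.

Section TruncatedSeries.
Variables (K : comNzRingType) (N : nat).
Local Notation quot := {poly %/ ('X^(N.+1) : {poly K})}.
Local Notation proj := (in_qpoly ('X^(N.+1) : {poly K})).

Implicit Types x y : nat -> K.

(** Power series in z modulo z^(N+1), enough for reading off one coefficient. *)
Definition series (x : nat -> K) : quot := proj (\poly_(i < N.+1) x i).

Lemma proj_eq (u v : {poly K}) :
  proj u = proj v <-> forall i, (i <= N)%N -> u`_i = v`_i.
Proof.
have valE w : val (proj w) = take_poly N.+1 w.
  by rewrite Pdiv.RingMonic.take_poly_rmodp /= mk_monic_Xn.
split=> [/(congr1 val)|e]; last apply: val_inj; rewrite !valE.
  by move=> /polyP e i le_iN; have := e i; rewrite !coef_take_poly ltnS le_iN.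
by apply/polyP => i; rewrite !coef_take_poly ltnS; case: ifP => // /e.
Qed.

Lemma eq_series x y :
  series x = series y <-> forall i, (i <= N)%N -> x i = y i.
Proof.
rewrite proj_eq; split=> e i le_iN; have := e i le_iN.
  by rewrite !coef_poly ltnS le_iN.
by rewrite !coef_poly ltnS le_iN.
Qed.

Lemma series1 : series (fun i => (i == 0%N)%:R) = 1.
Proof.
rewrite -(in_qpoly1 ('X^(N.+1) : {poly K})); apply/proj_eq => i le_iN.
by rewrite coef1 coef_poly ltnS le_iN.
Qed.

Lemma seriesD x y : series (fun i => x i + y i) = series x + series y.
Proof.
rewrite /series -raddfD; apply/proj_eq => i le_iN.
by rewrite coefD !coef_poly ltnS le_iN.
Qed.

Lemma seriesB x y : series (fun i => x i - y i) = series x - series y.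
Proof.
rewrite /series -raddfB; apply/proj_eq => i le_iN.
by rewrite coefB !coef_poly ltnS le_iN.
Qed.

Lemma seriesZ c x : series (fun i => c * x i) = proj c%:P * series x.
Proof.
rewrite /series -rmorphM; apply/proj_eq => i le_iN.
by rewrite coefCM !coef_poly ltnS le_iN.
Qed.

Lemma seriesM x y :
  series (fun n => \sum_(i < n.+1) x i * y (n - i)%N) = series x * series y.
Proof.
rewrite /series -rmorphM; apply/proj_eq => n le_nN.
rewrite coefM coef_poly ltnS le_nN; apply: eq_bigr => i _.
rewrite !coef_poly !ltnS (leq_trans (leq_ord i)) //.
by rewrite (leq_trans (leq_subr _ _)).
Qed.

Lemma seriesX x :
  series (fun n => if n is n'.+1 then x n' else 0) = proj 'X * series x.
Proof.
rewrite /series -rmorphM; apply/proj_eq => n le_nN.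
rewrite coefXM !coef_poly ltnS le_nN; case: n le_nN => //= n lt_nN.
by rewrite ltnS ltnW.
Qed.

End TruncatedSeries.

(** * The q-difference equation and its coefficients *)

Section QDifference.
Variables (K : fieldType) (q t : K).
Variables p D A W B : nat -> K.
Hypotheses (p0 : p 0%N = 1) (pS : forall n, p n.+1 = p n * (1 - q ^+ n.+1)).
Hypotheses (p_neq0 : forall n, p n != 0) (t1 : t != 1).
Hypothesis A_D : forall n,
  A n / p n = \sum_(k < n.+1) (p k)^-1 * (D (n - k)%N / p (n - k)%N).
Hypothesis W_D : forall n,
  W n / p n = \sum_(k < n.+1) (t ^+ k / p k) * (D (n - k)%N / p (n - k)%N).
Hypothesis W_A : forall n, W n = (n == 0%N)%:R * (1 - t) + t * A n.
Hypothesis B_W : forall n,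
  B n / p n = \sum_(k < n.+1) (p k)^-1 * (W (n - k)%N / p (n - k)%N).

Lemma qdiff_recurrence n :
  B n.+1 / p n = B n / p n
    + t * \sum_(k < n.+1) q ^+ k * (A k / p k) * (B (n - k)%N / p (n - k)%N).
Proof.
(* [T] is the substitution of qz for z, hence multiplicative. *)
pose N := n.+1; pose T x := series N (fun i => q ^+ i * x i).
pose h i := (p i)^-1; pose g i := t ^+ i / p i.
pose d i := D i / p i; pose a i := A i / p i.
pose w i := W i / p i; pose b i := B i / p i.
have TM (x y z : nat -> K) :
    (forall n, x n = \sum_(k < n.+1) y k * z (n - k)%N) ->
    T x = T y * T z.
  move=> e; rewrite -seriesM; apply/eq_series => i _; rewrite e mulr_sumr.
  by apply: eq_bigr => k _; rewrite -{1}(subnKC (leq_ord k)) exprD; ring.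
have SM (x y z : nat -> K) :
    (forall n, x n = \sum_(k < n.+1) y k * z (n - k)%N) ->
    series N x = series N y * series N z.
  by move=> e; rewrite -seriesM; apply/eq_series => i _.
pose z : {poly %/ ('X^(N.+1) : {poly K})} := in_qpoly _ 'X.
pose c (u : K) : {poly %/ ('X^(N.+1) : {poly K})} := in_qpoly _ u%:P.
have w_a i : w i = (1 - t) * (i == 0%N)%:R + t * a i.
  by rewrite /w /a W_A; case: i => [|i] /=; rewrite ?p0 ?divr1; ring.
have E : series N w = 1 - c t + c t * series N a.
  transitivity (series N (fun i => (1 - t) * (i == 0%N)%:R + t * a i)).
    by apply/eq_series => i _.
  by rewrite seriesD !seriesZ series1 mulr1 /c polyCB rmorphB rmorph1.
have E' : T w = 1 - c t + c t * T a.
  transitivity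
    (series N (fun i => (1 - t) * (i == 0%N)%:R + t * (q ^+ i * a i))).
    by apply/eq_series => -[|i] _; rewrite w_a /=; ring.
  by rewrite seriesD !seriesZ series1 mulr1 /c polyCB rmorphB rmorph1.
have Eh : T h = (1 - z) * series N h.
  rewrite mulrBl mul1r /z -seriesX -seriesB; apply/eq_series => -[|i] _.
    by rewrite mul1r subr0.
  have := p_neq0 i.+1; rewrite /h pS mulf_eq0 negb_or => /andP[].
  by move: (q ^+ _) (p i) => Q P P0 Q0; field; rewrite P0.
have Eg : T g = (1 - c t * z) * series N g.
  rewrite mulrBl mul1r /z -mulrA -seriesX -seriesZ -seriesB.
  apply/eq_series => -[|i] _; first by rewrite mul1r mulr0 subr0.
  have := p_neq0 i.+1; rewrite /g pS mulf_eq0 negb_or (exprS t) => /andP[].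
  by move: (q ^+ _) (p i) (t ^+ i) => Q P u P0 Q0; field; rewrite P0.
have := qdiff_identity (SM a h d A_D) (SM w g d W_D) E (SM b h w B_W)
  (TM a h d A_D) (TM w g d W_D) E' (TM b h w B_W) Eh Eg.
have -> : series N b * (1 + c t * T a) = series N (fun n => b n + t *
    \sum_(k < n.+1) q ^+ k * a k * b (n - k)%N).
  by rewrite seriesD seriesZ (seriesM _ (fun k => q ^+ k * a k) b) /c /T; ring.
have -> : 1 - c t = c (1 - t) by rewrite /c polyCB rmorphB rmorph1.
(* The top coefficient, of degree [n.+1], is compared; the factor [1 - q ^+ n.+1] of its left side
   turns [p n.+1] into [p n]. *)
rewrite -seriesX -seriesB -!seriesZ => /eq_series/(_ _ (leqnn _)).
have t1' : 1 - t != 0 by rewrite subr_eq0 eq_sym.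
move/(mulfI t1') => <-; rewrite /b pS.
have := p_neq0 n.+1; rewrite pS mulf_eq0 negb_or => /andP[].
by move: (q ^+ _) (p n) => Q P P0 Q0; field; rewrite P0 andbT.
Qed.
End QDifference.

(** * Agreement of the q-binomial coefficients, and assembly in the fraction field *)

Lemma gauss_qpoch n k : (k <= n)%N ->
  gauss 'X n k * (qpoch k * qpoch (n - k)) = qpoch n.
Proof.
have qpoch0 : qpoch 0 = 1 by rewrite /qpoch big_geq.
elim: n k => [|n IH] [|k] // le_kn; rewrite ?gaussn0 ?subn0 ?qpoch0 ?mul1r //.
rewrite gaussS subSS mulrDl; move: le_kn; rewrite ltnS leq_eqVlt.
case/predU1P=> [->|lt_kn].
  by rewrite (gauss_small _ (ltnSn n)) gaussnn subnn qpoch0; ring.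
have := IH _ lt_kn; have := IH _ (ltnW lt_kn).
have -> : (n - k = (n - k.+1).+1)%N by lia.
rewrite !qpochS => e1 e2.
have -> : 'X^(n.+1) = 'X^(k.+1) * 'X^((n - k.+1).+1) :> {poly int}.
  by rewrite -exprD; congr ('X^_); lia.
(* This splits 1 - q^(n+1) as (1 - q^(k+1)) + q^(k+1) (1 - q^(n-k)). *)
transitivity (qpoch n * (1 - 'X^(k.+1)) +
   'X^(k.+1) * (qpoch n * (1 - 'X^((n - k.+1).+1)))); last by ring.
rewrite -{1}e1 -{1}e2; ring.
Qed.

Lemma qpoch_neq0 n : qpoch n != 0.
Proof.
by rewrite -lead_coef_eq0; apply: contraTneq (lead_coef_qpoch n) => ->.
Qed.

Lemma rmorph_gauss (R S : pzSemiRingType) (f : {rmorphism R -> S}) q n k :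
  f (gauss q n k) = gauss (f q) n k.
Proof.
elim: n k => [|n IH] [|k] /=; rewrite ?rmorph1 ?rmorph0 //.
by rewrite rmorphD rmorphM rmorphXn !IH.
Qed.

Lemma qbinomE n k : (k <= n)%N -> (qbinom n k)%:P = gauss qvar n k.
Proof.
move=> le_kn; rewrite -rmorph_gauss; congr _%:P.
apply: (mulIf (mulf_neq0 (qpoch_neq0 k) (qpoch_neq0 (n - k)))).
by rewrite qbinomK // gauss_qpoch.
Qed.

Lemma eulerA0 : eulerA 0 = 1.
Proof.
rewrite /eulerA (eq_bigr (fun=> 1)) => [|s _].
  by rewrite sumr_const card_Sn.
by rewrite /exc /maj !big_geq // mulr1.
Qed.

Theorem theorem1p4 :
  binomEulerA 0 = 1 /\
  forall n : nat,
    binomEulerA n.+1 =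
      (1 + tvar) * binomEulerA n
      + tvar * \sum_(1 <= k < n.+1)
          (qbinom n k)%:P * qvar ^+ k * eulerA k * binomEulerA (n - k).
Proof.
split; first by rewrite /binomEulerA big_geq // mulr0 addr0.
have qvar0 : qvar != 0 by rewrite polyC_eq0 polyX_eq0.
pose F : {rmorphism {poly {poly int}} -> {fraction {poly {poly int}}}} :=
  @tofrac {poly {poly int}}.
pose D k := eulersum tvar qvar (@derang k).
have A_D n : eulerA n = \sum_(0 <= k < n.+1) gauss qvar n k * D k.
  exact: eulersum_derang.
have D0 : D 0 = 1.
  by rewrite -eulerA0 A_D big_nat1 gaussn0 mul1r.
(* These are the numerators of 1 - t + t a(z): 1 for [n = 0], as [eulerA 0 = 1], and t A_n
   otherwise. *)
pose W n := (n == 0%N)%:R * (1 - tvar) + tvar * eulerA n.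
have W_D n : W n = \sum_(0 <= k < n.+1) gauss qvar n k * tvar ^+ (n - k) * D k.
  case: n => [|n]; last by rewrite /W mul0r add0r; apply: eulersum_derang_shift.
  by rewrite big_nat1 D0 /W eulerA0 gaussn0 subnn eqxx !mulr1 !mul1r subrK.
have B_W n : binomEulerA n = \sum_(0 <= k < n.+1) gauss qvar n k * W k.
  rewrite big_ltn // gaussn0 /W eulerA0 /binomEulerA mulr_sumr; congr (_ + _).
    by rewrite eqxx !mulr1 !mul1r subrK.
  apply: eq_big_nat => -[|k] // /andP[_ le_kn].
  by rewrite qbinomE // mul0r add0r mulrCA.
pose p n := F (qpoch n)%:P.
have p_neq0 m : p m != 0 by rewrite /p /F /= tofrac_eq0 polyC_eq0 qpoch_neq0.
(* Division by (q;q)_n turns a q-binomial convolution into a Cauchy product; the index is reversed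
   to put the q-exponential factor first. *)
have gauss_div n (x : nat -> {poly {poly int}}) :
    F (\sum_(0 <= k < n.+1) gauss qvar n k * x k) / p n
    = \sum_(k < n.+1) (p k)^-1 * (F (x (n - k)%N) / p (n - k)%N).
  rewrite rmorph_sum mulr_suml /= big_mkord.
  rewrite (reindex_inj rev_ord_inj) /=; apply: eq_bigr => k _.
  rewrite subSS rmorphM /= -qbinomE ?leq_subr //.
  have := congr1 (fun u => F u%:P) (qbinomK (leq_subr k n)).
  rewrite subKn ?leq_ord // !rmorphM /= -/(p _) -/(p _) -/(p _) => e.
  have := p_neq0 n; rewrite -e !mulf_eq0 !negb_or => /andP[b0 _].
  by rewrite -mulf_div divff // mul1r invfM mulrA mulrC.
have p0 : p 0%N = 1 by rewrite /p /qpoch big_geq // rmorph1.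
have pS n : p n.+1 = p n * (1 - F qvar ^+ n.+1).
  by rewrite /p qpochS !rmorphM !rmorphB !rmorph1 -!rmorphXn.
have t1 : F tvar != 1.
  by rewrite -subr_eq0 -(rmorph1 F) -rmorphB tofrac_eq0 -size_poly_gt0 size_XsubC.
have FA n : F (eulerA n) / p n =
    \sum_(k < n.+1) (p k)^-1 * (F (D (n - k)%N) / p (n - k)%N).
  by rewrite A_D gauss_div.
have FW n : F (W n) / p n =
    \sum_(k < n.+1) (F tvar ^+ k / p k) * (F (D (n - k)%N) / p (n - k)%N).
  rewrite W_D; under eq_bigr => k _ do rewrite -mulrA.
  rewrite (gauss_div n (fun k => tvar ^+ (n - k) * D k)).
  apply: eq_bigr => k _; rewrite subKn ?leq_ord // rmorphM rmorphXn /=.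
  by rewrite -[RHS]mulrA -[X in _ * X = _]mulrA mulrCA.
have WA n : F (W n) = (n == 0%N)%:R * (1 - F tvar) + F tvar * F (eulerA n).
  by rewrite rmorphD !rmorphM rmorphB rmorph1 rmorph_nat.
have FB n : F (binomEulerA n) / p n =
    \sum_(k < n.+1) (p k)^-1 * (F (W (n - k)%N) / p (n - k)%N).
  by rewrite B_W gauss_div.
move=> n; apply/eqP; rewrite -tofrac_eq -/(F _) -/(F _); apply/eqP.
apply: (divIf (p_neq0 n)); rewrite /=.
rewrite (@qdiff_recurrence _ _ _ _ (F \o D) _ _ _ p0 pS p_neq0 t1 FA FW WA FB).
(* The summand t times [binomEulerA n] is the term [k = 0] of the full sum. *)
have -> : (1 + tvar) * binomEulerA n
      + tvar * \sum_(1 <= k < n.+1)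
          (qbinom n k)%:P * qvar ^+ k * eulerA k * binomEulerA (n - k)
    = binomEulerA n + tvar * \sum_(k < n.+1)
          (qbinom n k)%:P * qvar ^+ k * eulerA k * binomEulerA (n - k).
  rewrite -(big_mkord xpredT (fun k => (qbinom n k)%:P * qvar ^+ k * eulerA k
    * binomEulerA (n - k))) [in RHS]big_ltn //.
  by rewrite qbinomE // gaussn0 eulerA0 subn0; ring.
rewrite tofracD tofracM rmorph_sum mulrDl -mulrA mulr_suml.
congr (_ + _ * _); apply: eq_bigr => k _; rewrite /= !tofracM tofracXn.
have := congr1 (fun u => F u%:P) (qbinomK (leq_ord k)).
rewrite !rmorphM /= -/(p _) -/(p _) -/(p _) => e.
have := p_neq0 n; rewrite -e mulf_eq0 negb_or => /andP[b0 _].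
rewrite -(mulrA (tofrac _)) -(mulrA (tofrac _)) -mulf_div divff // mul1r.
by rewrite -[in RHS]mulf_div -[X in _ = X * _]mulrA.
Qed.
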